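(* Let $k\in\mathbb{N}$ and $S=\langle 6k+7,6k+11,6k+13\rangle$. Then \[\mathrm{Ap}(S,6k+7)=\{a(6k+11)+b(6k+13)\mid (a,b)\in C\},\] where $C=\big(\{0,1,2\}\times\{0,1,\dots,2k+2\}\big)\setminus\{(2,2k+1),(2,2k+2)\}$.
   Context: $\mathbb{N}=\{0,1,2,\dots\}$. For $X\subseteq\mathbb{N}$, $\langle X\rangle$ is the submonoid of $(\mathbb{N},+)$ generated by $X$; here it is a numerical semigroup. For a numerical semigroup $S$ and $n\in S\setminus\{0\}$, the Apéry set is $\mathrm{Ap}(S,n)=\{s\in S\mid s-n\notin S\}$. *)

(* Defs.v *)
(* MathComp world; subsets of nat are classical sets. *)
From mathcomp Require Import all_boot all_algebra.
From mathcomp Require Import classical_sets.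

Set Implicit Arguments.
Unset Strict Implicit.
Unset Printing Implicit Defensive.

Import GRing.Theory.
Local Open Scope classical_set_scope.

Definition submonoid (M : set nat) : Prop :=
  M 0 /\ (forall x y, M x -> M y -> M (x + y)).

Definition generated_submonoid (X : set nat) : set nat := smallest submonoid X.

(* The difference s - n is taken in the integers (not truncated), so that
   s - n is not in S whenever s < n. *)
Definition apery (S : set nat) (n : nat) : set nat :=
  [set s | S s /\ ~ (Posz @` S) (s%:Z - n%:Z)%R].

(* Main.v *)
(** Write m = 6k+7, x = m+4 and y = m+6.  The relations
      3x = 2y + m,   (2k+3)y = x + (2k+4)m,   2x + (2k+1)y = (2k+5)m
    show that an element ax + by with (a,b) outside C remains in S after
    subtracting m, and iterating them brings every ax + by to the form
    cm + px + qy with (p,q) in C.  The numbers px + qy with (p,q) in C are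
    pairwise incongruent modulo m, so none of them remains in S after
    subtracting m. *)
Require Import Defs.
From mathcomp Require Import all_boot all_algebra.
From mathcomp Require Import classical_sets.
From mathcomp Require Import order zify ring.

Import Order.TTheory Num.Theory.
Local Open Scope classical_set_scope.

Lemma generated_submonoidP (m x y s : nat) :
  generated_submonoid [set m; x; y] s <->
  exists c a b, s = c * m + a * x + b * y.
Proof.
split.
  move=> /(_ [set s | exists c a b, s = c * m + a * x + b * y]); apply; split.
    split; first by exists 0, 0, 0.
    move=> _ _ [c [a [b ->]]] [c' [a' [b' ->]]].
    exists (c + c'), (a + a'), (b + b'); ring.
  move=> _ [[->|->]|->]; [exists 1, 0, 0|exists 0, 1, 0|exists 0, 0, 1]; lia.
move=> [c [a [b ->]]] M [[M0 MD] sub].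
have MM n z : M z -> M (n * z).
  by move=> Mz; elim: n => // n IHn; rewrite mulSn; exact: MD.
apply: (MD); [apply: (MD)|]; apply: MM; apply: sub; [left; left|left; right|right]; done.
Qed.

(** Boolean form of $(a,b)\in C$, so that case analysis and [lia] apply; given [b <= 2 * k + 2], the
    implication removes exactly the two excluded pairs. *)
Definition reduced (k a b : nat) : bool :=
  [&& a <= 2, b <= 2 * k + 2 & (a == 2) ==> (b <= 2 * k)].

(** Each case uses one of the three relations. The coefficient [c.+1] guarantees that a copy of $m$
    splits off; the drop of [a + b] makes iteration terminate. *)
Lemma reduction_step (k a b : nat) : ~~ reduced k a b ->
  exists c a' b', a' + b' < a + b /\
    a * (6 * k + 11) + b * (6 * k + 13) =
    c.+1 * (6 * k + 7) + a' * (6 * k + 11) + b' * (6 * k + 13).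
Proof.
move=> nred.
have [a3|a3] := leqP 3 a.
  exists 0, (a - 3), (b + 2); split; first lia.
  have [d ->] : exists d, a = d + 3 by exists (a - 3); lia.
  rewrite addnK; ring.
have [b3|b3] := leqP (2 * k + 3) b.
  exists (2 * k + 3), (a + 1), (b - (2 * k + 3)); split; first lia.
  have [d ->] : exists d, b = d + (2 * k + 3) by exists (b - (2 * k + 3)); lia.
  rewrite addnK; ring.
have [-> b1] : a = 2 /\ 2 * k + 1 <= b by move: nred; rewrite /reduced; lia.
exists (2 * k + 4), 0, (b - (2 * k + 1)); split; first lia.
have [d ->] : exists d, b = d + (2 * k + 1) by exists (b - (2 * k + 1)); lia.
rewrite addnK; ring.
Qed.

Lemma reduction (k a b : nat) : exists c p q, reduced k p q /\
  a * (6 * k + 11) + b * (6 * k + 13) =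
  c * (6 * k + 7) + p * (6 * k + 11) + q * (6 * k + 13).
Proof.
have [n] := ubnP (a + b); elim: n a b => // n IHn a b ltn.
have [red|/reduction_step [c [a' [b' [lt eq1]]]]] := boolP (reduced k a b).
  by exists 0, a, b.
have [|c' [p [q [red eq2]]]] := IHn a' b'; first lia.
exists (c.+1 + c'), p, q; split=> //.
by rewrite eq1 -addnA eq2 mulnDl !addnA.
Qed.

Lemma reduced_incongruent (k a b p q c : nat) :
  reduced k a b -> reduced k p q ->
  a * (6 * k + 11) + b * (6 * k + 13) <>
  c.+1 * (6 * k + 7) + p * (6 * k + 11) + q * (6 * k + 13).
Proof.
move=> redab redpq eqn.
(* Since $x=m+4$ and $y=m+6$, collecting the multiples of $m$ gives $tm=4(a-p)+6(b-q)$. *)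
have [t tD] : exists t : int, (t = c.+1%:Z + p%:Z + q%:Z - a%:Z - b%:Z)%R.
  by eexists.
have tE : (t * (6 * k%:Z + 7) = 4 * (a%:Z - p%:Z) + 6 * (b%:Z - q%:Z))%R by nia.
clear eqn; move: redab redpq => /and3P[a2 b2 ab] /and3P[p2 q2 pq].
have m0 : (0 <= 6 * k%:Z + 7)%R by lia.
(* The right side is at most $8+6(2k+2)=12k+20<3m$ in absolute value. *)
have tub : (t < 3)%R.
  by rewrite ltNge; apply/negP => /(ler_wpM2r m0); rewrite tE; lia.
have tlb : (-3 < t)%R.
  by rewrite ltNge; apply/negP => /(ler_wpM2r m0); rewrite tE; lia.
have : (t = -2 \/ t = -1 \/ t = 0 \/ t = 1 \/ t = 2)%R by lia.
(* Odd $t$ fails by parity, as $m$ is odd. If $t=0$, then $3\mid a-p$, so $(a,b)=(p,q)$ and [tD]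
   gives [c.+1] $=0$. If $t=2$, then $(a-p,b-q)$ is $(2,2k+1)$, excluded by $C$, or has $b-q\ge
   2k+3$; $t=-2$ is symmetric. *)
by move=> [tv|[tv|[tv|[tv|tv]]]]; rewrite tv in tE; lia.
Qed.

Theorem theorem14 (k : nat) :
  let S := generated_submonoid [set 6 * k + 7; 6 * k + 11; 6 * k + 13] in
  let C := ([set a : nat | a <= 2] `*` [set b : nat | b <= 2 * k + 2])
             `\` [set (2, 2 * k + 1); (2, 2 * k + 2)] in
  apery S (6 * k + 7) =
    [set c.1 * (6 * k + 11) + c.2 * (6 * k + 13) | c in C].
Proof.
move=> S C.
have CP a b : C (a, b) <-> reduced k a b.
  split.
    move=> [[/= a2 b2] nab]; apply/and3P; split=> //.
    apply/implyP => /eqP aE; subst a.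
    have [//|b1] := leqP b (2 * k); case: nab.
    have [->|->] : b = 2 * k + 1 \/ b = 2 * k + 2 by lia.
      by left.
    by right.
  move=> /and3P[a2 b2 ab]; split; first by split.
  by case=> -[aE bE]; move: ab; rewrite aE bE; lia.
apply/seteqP; split=> s.
  move=> [/generated_submonoidP [c [a [b ->]]] nS].
  have notS c' a' b' : c * (6 * k + 7) + a * (6 * k + 11) + b * (6 * k + 13)
      <> c'.+1 * (6 * k + 7) + a' * (6 * k + 11) + b' * (6 * k + 13).
    move=> sE; apply: nS.
    exists (c' * (6 * k + 7) + a' * (6 * k + 11) + b' * (6 * k + 13)).
      by apply/generated_submonoidP; exists c', a', b'.
    rewrite sE (mulSn c'); lia.
  (* A positive coefficient of $m$ would put $s-m$ in $S$, so $c=0$; a reduction step on [(a, b)]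
     would create such a coefficient. *)
  case: c => [|c] in nS notS *; last by case: (notS c a b).
  exists (a, b) => //; apply/CP; apply: contraT.
  by move=> /reduction_step [c' [a' [b' [_ sE]]]]; case: (notS c' a' b').
move=> [[a b] /CP red <-] /=; split.
  by apply/generated_submonoidP; exists 0, a, b.
move=> [_ /generated_submonoidP [c [a' [b' ->]]] sE].
have [c' [p [q [redpq eq1]]]] := reduction k a' b'.
(* Moving $m$ across in [sE] supplies the successor in [(c + c').+1]. *)
apply: (@reduced_incongruent k a b p q (c + c') red redpq).
move: sE; rewrite -addnA eq1 => sE.
rewrite (mulSn (c + c')) mulnDl; lia.
Qed.
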